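(* Let $K\subset\mathbb{R}^2$ be a triangle with side lengths $x$, $y$, and $1$ such that $0<x<y<1<x+y$. Let $y_0\approx 0.819173$ be the unique positive real solution of the equation $y^4+y^3=1$, and define $\Psi_1,\Psi_2:(\frac12,1)\to\mathbb{R}$ by $$\Psi_1(y)=\begin{cases}0&\text{if }y\le\frac{\sqrt2}{2},\\ \sqrt{\frac{y^3+y-1}{y}}&\text{if }\frac{\sqrt2}{2}<y\le y_0,\\ y^2&\text{if }y>y_0,\end{cases}\qquad \Psi_2(y)=\begin{cases}\frac12\left(\sqrt{y^2+4}-y\right)&\text{if }y\le y_0,\\ y^2&\text{if }y>y_0.\end{cases}$$ Let $$\Omega=\{(x,y)\in\mathbb{R}^2 : 0<x<y<1<x+y\},\quad \mathcal{L}=\{(x,y)\in\Omega : x>\Psi_2(y)\},$$ $$\mathcal{S}=\{(x,y)\in\Omega : x\le\Psi_1(y)\},\quad \mathcal{P}=\Omega\setminus(\mathcal{L}\cup\mathcal{S}).$$ Then $\alpha_1(K)=R(K,\Phi_U(K))$, where (i) $U$ is the bisector of the largest interior angle of $K$ whenever $(x,y)\in\mathcal{L}$, (ii) $U$ is the bisector of the smallest interior angle of $K$ whenever $(x,y)\in\mathcal{S}$, and (iii) $U$ is perpendicular to the longest edge of $K$ whenever $(x,y)\in\mathcal{P}$.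
   Context: Triangles are non-degenerate. The bisector of an interior angle of a triangle is the one that meets the interior of the triangle. For an affine subspace $U\subset\mathbb{R}^2$, $P_U$ is the orthogonal projection onto $U$ and $\Phi_U(x)=2P_U(x)-x$ is the reflection across $U$. For convex bodies (compact convex sets with nonempty interior) $K,C\subset\mathbb{R}^2$, $R(K,C)=\inf\{\lambda>0 : K\subset z+\lambda C\text{ for some }z\in\mathbb{R}^2\}$. The first Minkowski chirality is $\alpha_1(K)=\inf\{R(K,\Phi_U(K)) : U\subset\mathbb{R}^2\text{ affine subspace},\ \dim U=1\}$. *)

(* Defs.v *)
From mathcomp Require Import all_boot all_order all_algebra.
From mathcomp Require Import boolp classical_sets reals topology normedtype.
From mathcomp Require Import convex trigo.

Set Implicit Arguments.
Unset Strict Implicit.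
Unset Printing Implicit Defensive.

Import Order.TTheory GRing.Theory Num.Theory.
Import numFieldNormedType.Exports.

Local Open Scope classical_set_scope.
Local Open Scope ring_scope.

(* The library norm on 'rV[R]_2 is the sup norm, hence the Euclidean one here;
   both induce the same topology, so interiors are unaffected. *)
Definition dot (R : realType) (u v : 'rV[R]_2) : R := (u *m v^T) 0 0.

Definition enorm (R : realType) (u : 'rV[R]_2) : R := Num.sqrt (dot u u).

Definition angle (R : realType) (p q r : 'rV[R]_2) : R :=
  acos (dot (p - q) (r - q) / (enorm (p - q) * enorm (r - q))).

Definition affine_subspace (R : realType) (k : nat) (U : set 'rV[R]_2) : Prop :=
  exists (p : 'rV[R]_2) (V : {vspace 'rV[R]_2}),
    \dim V = k /\ U = [set x | x - p \in V].

(* For an affine subspace U there is exactly one such point p, so the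
   default value 0 of [xget] is never used. *)
Definition proj (R : realType) (U : set 'rV[R]_2) (x : 'rV[R]_2) : 'rV[R]_2 :=
  xget 0 [set p | U p /\ forall q, U q -> dot (x - p) (q - p) = 0].

Definition reflection (R : realType) (U : set 'rV[R]_2) (x : 'rV[R]_2) :
    'rV[R]_2 :=
  2 *: proj U x - x.

Definition circumradius (R : realType) (K C : set 'rV[R]_2) : R :=
  inf [set l : R | 0 < l /\
         exists z : 'rV[R]_2, K `<=` [set z + l *: c | c in C]].

Definition chirality1 (R : realType) (K : set 'rV[R]_2) : R :=
  inf [set circumradius K (reflection U @` K) | U in affine_subspace 1].

Definition convex_hull (R : realType) (A : set 'rV[R]_2) : set 'rV[R]_2 :=
  smallest (@convex_set R 'rV[R]_2) A.

Definition is_triangle (R : realType) (v : 'I_3 -> 'rV[R]_2)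
    (K : set 'rV[R]_2) : Prop :=
  free [:: v 1 - v 0; v 2 - v 0] /\ K = convex_hull (range v).

(* Vertices are indexed by 'I_3 with its arithmetic modulo 3: the vertices
   other than [v i] are [v (i + 1)] and [v (i + 2)]. *)
Definition side_length (R : realType) (v : 'I_3 -> 'rV[R]_2) (i : 'I_3) : R :=
  enorm (v (i + 1) - v (i + 2)).

Definition interior_angle (R : realType) (v : 'I_3 -> 'rV[R]_2) (i : 'I_3) : R :=
  angle (v (i + 1)) (v i) (v (i + 2)).

Definition is_angle_bisector (R : realType) (v : 'I_3 -> 'rV[R]_2)
    (K : set 'rV[R]_2) (i : 'I_3) (U : set 'rV[R]_2) : Prop :=
  [/\ affine_subspace 1 U, U (v i), U `&` interior K !=set0 &
      forall w, (U `&` interior K) w ->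
        angle (v (i + 1)) (v i) w = angle w (v i) (v (i + 2))].

Definition bisects_largest_angle (R : realType) (v : 'I_3 -> 'rV[R]_2)
    (K U : set 'rV[R]_2) : Prop :=
  exists i : 'I_3, (forall j, interior_angle v j <= interior_angle v i) /\
    is_angle_bisector v K i U.

Definition bisects_smallest_angle (R : realType) (v : 'I_3 -> 'rV[R]_2)
    (K U : set 'rV[R]_2) : Prop :=
  exists i : 'I_3, (forall j, interior_angle v i <= interior_angle v j) /\
    is_angle_bisector v K i U.

Definition perp_longest_edge (R : realType) (v : 'I_3 -> 'rV[R]_2)
    (U : set 'rV[R]_2) : Prop :=
  affine_subspace 1 U /\
  exists i : 'I_3, (forall j, side_length v j <= side_length v i) /\
    forall p q, U p -> U q -> dot (p - q) (v (i + 1) - v (i + 2)) = 0.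

(* Total on R; only the values on ]1/2, 1[ are relevant, as (x, y) in Omega
   forces 1/2 < y < 1. *)
Definition Psi1 (R : realType) (y0 y : R) : R :=
  if y <= Num.sqrt 2 / 2 then 0
  else if y <= y0 then Num.sqrt ((y ^+ 3 + y - 1) / y)
  else y ^+ 2.

Definition Psi2 (R : realType) (y0 y : R) : R :=
  if y <= y0 then 2^-1 * (Num.sqrt (y ^+ 2 + 4) - y)
  else y ^+ 2.

Definition Omega (R : realType) : set (R * R) :=
  [set p | let: (x, y) := p in [/\ 0 < x, x < y, y < 1 & 1 < x + y]].

Definition regionL (R : realType) (y0 : R) : set (R * R) :=
  [set p | Omega p /\ let: (x, y) := p in Psi2 y0 y < x].

Definition regionS (R : realType) (y0 : R) : set (R * R) :=
  [set p | Omega p /\ let: (x, y) := p in x <= Psi1 y0 y].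

Definition regionP (R : realType) (y0 : R) : set (R * R) :=
  @Omega R `\` (regionL y0 `|` regionS y0).

(* Main.v *)
(* Writing C for the reflected triangle, [R(K, C)] depends only on the linear
   part of the reflection, hence on a unit vector [(c, s)] (the doubled angle
   of the axis), and it is a maximum of linear forms in [(c, s)]: summing the
   three barycentric constraints, [K] fits into a translate of [l C] iff [l] is
   at least the sum over the edges of [C] of the largest value taken at a vertex
   of [K] by a suitable multiple of the outer normal.  Such a maximum has its
   minima on the unit circle where the maximising vertices change, that is, when
   some edge of [K] is reflected to the direction of an edge with the same outer
   normal: [U] is perpendicular to an edge or is an interior bisector.  For the
   largest angle, the smallest angle and the longest edge this gives the values
   [y / x], [1 / y] and [1 + y^2 - x^2]; the other three candidates are never
   smaller than all of these, and the three regions compare these numbers. *)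
Require Import Defs.
From mathcomp Require Import all_boot all_order all_algebra.
From mathcomp Require Import boolp classical_sets reals topology normedtype.
From mathcomp Require Import convex trigo interval_inference ring lra.

Set Implicit Arguments.
Unset Strict Implicit.
Unset Printing Implicit Defensive.

Import Order.TTheory GRing.Theory Num.Theory.
Import numFieldNormedType.Exports.

Local Open Scope classical_set_scope.
Local Open Scope ring_scope.

(** * Linear forms on the unit circle *)

Lemma ler_of_sqr (R : realFieldType) (a b : R) :
  0 <= b -> a ^+ 2 <= b ^+ 2 -> a <= b.
Proof.
move=> b0 ab; rewrite leNgt; apply/negP => ba; move: ab.
by rewrite leNgt ltr_pXn2r ?ba // nnegrE // (le_trans b0) // ltW.
Qed.

(** On the arc from [u / k] to [v / l], shorter than a half turn, [D (c, s) = m u + n v] with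
    [m, n >= 0], and the triangle inequality gives [D <= m k + n l]. So a linear form that is at
    least [r >= 0] at both ends of the arc is at least [r] on all of it. The lengths [k], [l] are
    given by their squares, which avoids square roots. *)
Lemma cone_lower_bound (R : realFieldType) (a1 a2 u1 u2 k v1 v2 l c s r : R) :
  0 <= k -> u1 ^+ 2 + u2 ^+ 2 = k ^+ 2 ->
  0 <= l -> v1 ^+ 2 + v2 ^+ 2 = l ^+ 2 ->
  c ^+ 2 + s ^+ 2 = 1 ->
  0 < u1 * v2 - u2 * v1 -> 0 <= u1 * s - u2 * c -> 0 <= c * v2 - s * v1 ->
  0 <= r -> r * k <= a1 * u1 + a2 * u2 -> r * l <= a1 * v1 + a2 * v2 ->
  r <= a1 * c + a2 * s.
Proof.
move=> k0 uk l0 vl cs D0 n0 m0 r0 au av.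
set D := u1 * v2 - u2 * v1 in D0 *.
set n := u1 * s - u2 * c in n0 *.
set m := c * v2 - s * v1 in m0 *.
have uv : u1 * v1 + u2 * v2 <= k * l.
  apply: ler_of_sqr; first exact: mulr_ge0.
  have -> : (k * l) ^+ 2 = (u1 * v1 + u2 * v2) ^+ 2 + D ^+ 2.
    by rewrite exprMn -uk -vl /D; ring.
  by rewrite lerDl sqr_ge0.
have Dmn : D <= m * k + n * l.
  apply: ler_of_sqr; first by rewrite addr_ge0 // mulr_ge0.
  have -> : D ^+ 2 = m ^+ 2 * k ^+ 2 + n ^+ 2 * l ^+ 2
      + m * n * (u1 * v1 + u2 * v2) *+ 2.
    by rewrite -[LHS]mul1r -cs -uk -vl /D /m /n; ring.
  have := ler_wpM2l (mulr_ge0 m0 n0) uv; nra.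
rewrite -(ler_pM2l D0).
have -> : D * (a1 * c + a2 * s) =
    m * (a1 * u1 + a2 * u2) + n * (a1 * v1 + a2 * v2).
  by rewrite /D /m /n; ring.
apply: le_trans (lerD (ler_wpM2l m0 au) (ler_wpM2l n0 av)).
have := ler_wpM2r r0 Dmn; nra.
Qed.

(* The six terms are values at the direction [(c, s)] of linear forms, each of
   them bounded below on the arc between two consecutive critical directions:
   the bisector at [A], the perpendicular to [BC], the bisector at [C], the
   perpendiculars to [AB] and to [AC], the bisector at [B]. *)
Lemma direction_lower_bound (R : realFieldType) (p q h x y c s r : R) :
  p + q = 1 -> 0 < h -> 0 < q -> q < p -> 0 < x -> x < y -> y < 1 ->
  x ^+ 2 = q ^+ 2 + h ^+ 2 -> y ^+ 2 = p ^+ 2 + h ^+ 2 ->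
  c ^+ 2 + s ^+ 2 = 1 ->
  0 <= r -> r * y <= 1 -> r * x <= y -> r <= 2 * p ->
  [\/ r * h <= s,
      r * h <= - s,
      r * h <= 2 * h * c + (q - p) * s |
   [\/ r * h <= - (2 * q * h) * c + (h ^+ 2 + p + p * q) * s,
       r * h <= - (2 * p * h) * c + (p ^+ 2 - h ^+ 2) * s |
       r * h <= - (2 * p * h) * c + (p ^+ 2 - h ^+ 2 - 1) * s]].
Proof.
move=> pq h0 q0 qp x0 xy y1 xE yE cs r0 rA rC rP.
have pE : p = 1 - q by lra.
have y0 := lt_trans x0 xy; have p0 := lt_trans q0 qp.
have x1 := lt_trans xy y1.
have rh0 : 0 <= r * h by rewrite mulr_ge0 // ltW.
(* Three critical values are dominated by the other three: [1 / x] at the bisector at [B] exceeds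
   [y / x], [2 q / x^2] at the perpendicular to [BC] is at least [1 / y], and [2 p / y^2] at the
   perpendicular to [AC] exceeds [2 p]. *)
have rB : r * x <= 1 by lra.
have y21 : y ^+ 2 < 1 by rewrite expr_lt1 // ltW.
have x21 : x ^+ 2 < 1 by rewrite expr_lt1 // ltW.
have ra : r * x ^+ 2 <= 2 * q.
  have qE : 2 * q = 1 + x ^+ 2 - y ^+ 2.
    by rewrite xE yE pE; ring.
  rewrite qE -(ler_pM2r y0).
  suff: x ^+ 2 * (1 - y) <= y * (1 - y) * (1 + y).
    by move: (ler_wpM2l (sqr_ge0 x) rA); nra.
  have : x ^+ 2 <= y ^+ 2 by rewrite ler_pXn2r // ?nnegrE; lra.
  move=> ?; nra.
have rb : r * y ^+ 2 <= 2 * p by nra.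
(* The critical directions before normalisation: as complex numbers, with [A = 0], [B = 1],
   [C = p + i h], they are [C], [-(C - B)^2], [C (C - B)], [-1], [-C^2] and [B - C]. *)
have nA : p ^+ 2 + h ^+ 2 = y ^+ 2 by [].
have na : (h ^+ 2 - q ^+ 2) ^+ 2 + (2 * q * h) ^+ 2 = (x ^+ 2) ^+ 2.
  by rewrite xE; ring.
have nC : (- (p * q + h ^+ 2)) ^+ 2 + (h * (p - q)) ^+ 2 = (x * y) ^+ 2.
  by rewrite [RHS]exprMn xE yE; ring.
have nP : (-1) ^+ 2 + 0 ^+ 2 = 1 ^+ 2 :> R by rewrite expr0n /= sqrrN addr0.
have nb : (h ^+ 2 - p ^+ 2) ^+ 2 + (- (2 * p * h)) ^+ 2 = (y ^+ 2) ^+ 2.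
  by rewrite yE; ring.
have nB : q ^+ 2 + (- h) ^+ 2 = x ^+ 2 by rewrite xE; ring.
have y2p : 0 <= y ^+ 2 by rewrite sqr_ge0.
have x2p : 0 <= x ^+ 2 by rewrite sqr_ge0.
have xyp : 0 <= x * y by rewrite mulr_ge0 // ltW.
(* This arc contains the direction [(1, 0)], so it is met for both signs of [s]. *)
have arcBA : 0 <= q * s - (- h) * c -> 0 <= c * h - s * p ->
    r * h <= 2 * h * c + (q - p) * s.
  move=> n0 m0.
  apply: (cone_lower_bound (ltW x0) nB (ltW y0) nA cs _ n0 m0 rh0).
  - by rewrite pE; lra.
  - by rewrite pE; move: (ler_wpM2r (ltW h0) rB); lra.
  - by rewrite pE; move: (ler_wpM2r (ltW h0) rA); lra.
have [s0|s0] := leP 0 s.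
  have [cA|cA] := leP (p * s - h * c) 0.
    apply: Or43; apply: arcBA; have := mulr_ge0 (ltW q0) s0;
      have := mulr_ge0 (ltW p0) s0; lra.
  have [ca|ca] := leP ((h ^+ 2 - q ^+ 2) * s - 2 * q * h * c) 0.
    apply: Or41.
    rewrite -[X in _ <= X](add0r s) -(mul0r c) -[X in _ <= 0 * c + X]mul1r.
    apply: (cone_lower_bound (ltW y0) nA x2p na cs _ _ _ rh0).
    - have -> : p * (2 * q * h) - h * (h ^+ 2 - q ^+ 2) =
        h * (1 - y ^+ 2) by rewrite yE pE; ring.
      by rewrite mulr_gt0 // subr_gt0.
    - exact: ltW.
    - lra.
    - move: (ler_wpM2r (ltW h0) rA); lra.
    - move: (ler_wpM2r (ltW h0) ra); lra.
  have [cC|cC] := leP (- (p * q + h ^+ 2) * s - h * (p - q) * c) 0.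
    apply: Or44; apply: Or31.
    apply: (cone_lower_bound x2p na xyp nC cs _ _ _ rh0).
    - have -> : (h ^+ 2 - q ^+ 2) * (h * (p - q)) -
          2 * q * h * - (p * q + h ^+ 2) = h * x ^+ 2 by rewrite xE pE; ring.
      by rewrite mulr_gt0 // exprn_gt0.
    - exact: ltW.
    - lra.
    - have -> : - (2 * q * h) * (h ^+ 2 - q ^+ 2) +
          (h ^+ 2 + p + p * q) * (2 * q * h) = 2 * q * h by rewrite pE; ring.
      move: (ler_wpM2r (ltW h0) ra); lra.
    - have -> : - (2 * q * h) * - (p * q + h ^+ 2) +
          (h ^+ 2 + p + p * q) * (h * (p - q)) = y ^+ 2 * h.
        by rewrite yE pE; ring.
      move: (ler_wpM2r (mulr_ge0 (ltW h0) (ltW y0)) rC); lra.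
  apply: Or44; apply: Or32.
  apply: (cone_lower_bound xyp nC ler01 nP cs _ _ _ rh0).
  - rewrite mulr0 mulrN1 sub0r opprK mulr_gt0 //; lra.
  - exact: ltW.
  - lra.
  - have -> : - (2 * p * h) * - (p * q + h ^+ 2) +
        (p ^+ 2 - h ^+ 2) * (h * (p - q)) = y ^+ 2 * h.
      by rewrite yE pE; ring.
    move: (ler_wpM2r (mulr_ge0 (ltW h0) (ltW y0)) rC); lra.
  - move: (ler_wpM2r (ltW h0) rP); lra.
have [cb|cb] := leP ((h ^+ 2 - p ^+ 2) * s + 2 * p * h * c) 0.
  apply: Or44; apply: Or33.
  apply: (cone_lower_bound ler01 nP y2p nb cs _ _ _ rh0).
  - rewrite mul0r mulN1r subr0 opprK !mulr_gt0 //.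
  - lra.
  - lra.
  - move: (ler_wpM2r (ltW h0) rP); lra.
  - have -> : - (2 * p * h) * (h ^+ 2 - p ^+ 2) +
        (p ^+ 2 - h ^+ 2 - 1) * - (2 * p * h) = 2 * p * h by ring.
    move: (ler_wpM2r (ltW h0) rb); lra.
have [cB|cB] := leP (q * s + h * c) 0.
  apply: Or42; rewrite -[X in _ <= X]add0r -(mul0r c) -mulN1r.
  apply: (cone_lower_bound y2p nb (ltW x0) nB cs _ _ _ rh0).
  - have -> : (h ^+ 2 - p ^+ 2) * - h - - (2 * p * h) * q =
        h * (1 - x ^+ 2) by rewrite xE pE; ring.
    by rewrite mulr_gt0 // subr_gt0.
  - lra.
  - lra.
  - move: (ler_wpM2r (ltW h0) rb); lra.
  - move: (ler_wpM2r (ltW h0) rB); lra.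
apply: Or43; apply: arcBA; first lra.
have := mulr_gt0 q0 (_ : 0 < - s); have := mulr_gt0 p0 (_ : 0 < - s); lra.
Qed.

(** * The three regions as polynomial inequalities *)

Section Regions.
Variable R : realType.
Implicit Types x y : R.

Lemma quartic_le1 (y0 : R) y : 0 < y -> y <= y0 -> y0 ^+ 4 + y0 ^+ 3 = 1 ->
  y ^+ 4 + y ^+ 3 <= 1.
Proof.
move=> y_gt0 yy0 <-; have y0_gt0 := lt_le_trans y_gt0 yy0.
by rewrite lerD // ler_pXn2r // nnegrE ltW.
Qed.

Lemma quartic_gt1 (y0 : R) y : 0 < y0 -> y0 < y -> y0 ^+ 4 + y0 ^+ 3 = 1 ->
  1 < y ^+ 4 + y ^+ 3.
Proof.
move=> y0_gt0 y0y <-; have y_gt0 := lt_trans y0_gt0 y0y.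
by rewrite ltrD // ltr_pXn2r // nnegrE ltW.
Qed.

(** The number compared with [x] is the positive root of [X^2 + y X - 1]. *)
Lemma Psi2_root x y : 0 < x -> 0 < y ->
  (2^-1 * (Num.sqrt (y ^+ 2 + 4) - y) < x) = (1 < x * (x + y)).
Proof.
move=> x0 y0; set r := Num.sqrt _.
have r0 : 0 <= r by exact: sqrtr_ge0.
have rE : r ^+ 2 = y ^+ 2 + 4 by rewrite sqr_sqrtr // addr_ge0 // sqr_ge0.
have -> : (2^-1 * (r - y) < x) = (r < 2 * x + y) by apply/idP/idP; lra.
have -> : (r < 2 * x + y) = (r ^+ 2 < (2 * x + y) ^+ 2).
  by rewrite ltr_pXn2r // nnegrE //; lra.
by rewrite rE; apply/idP/idP; lra.
Qed.

(** Cleared of denominators, [y / x <= 1 / y] and [y / x <= 1 + y^2 - x^2]. The curves [x = y^2] and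
    [x (x + y) = 1] meet where [y^4 + y^3 = 1], whence the change of formula at [y0]. *)
Lemma regionL_ineq (y0 : R) x y : 0 < y0 -> y0 ^+ 4 + y0 ^+ 3 = 1 ->
  regionL y0 (x, y) -> y ^+ 2 <= x /\ 1 <= x * (x + y).
Proof.
move=> y0_gt0 y0E [[x0 xy y1 xy1]].
have y_gt0 := lt_trans x0 xy.
rewrite /Psi2; have [yy0|yy0] := leP y y0.
  rewrite Psi2_root // => xyx; split; last exact: ltW.
  have := quartic_le1 y_gt0 yy0 y0E; nra.
move=> y2x; split; first exact: ltW.
have := quartic_gt1 y0_gt0 yy0 y0E; nra.
Qed.

(** Cleared of denominators, [1 / y <= y / x] and [1 / y <= 1 + y^2 - x^2]. *)
Lemma regionS_ineq (y0 : R) x y : 0 < y0 -> y0 ^+ 4 + y0 ^+ 3 = 1 ->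
  regionS y0 (x, y) -> x <= y ^+ 2 /\ x ^+ 2 * y <= y ^+ 3 + y - 1.
Proof.
move=> y0_gt0 y0E [[x0 xy y1 xy1]].
have y_gt0 := lt_trans x0 xy.
rewrite /Psi1; case: ifP => _; first by rewrite leNgt x0.
have [yy0|yy0] := leP y y0.
  (* For a nonpositive radicand the square root is 0, which [0 < x] excludes. *)
  have [E0|E0] := leP ((y ^+ 3 + y - 1) / y) 0.
    by rewrite ler0_sqrtr // leNgt x0.
  move=> xE.
  have : x ^+ 2 <= (y ^+ 3 + y - 1) / y.
    by rewrite -(sqr_sqrtr (ltW E0)) ler_pXn2r // ?nnegrE ?sqrtr_ge0 // ltW.
  rewrite ler_pdivlMr // => x2y; split=> //.
  have := quartic_le1 y_gt0 yy0 y0E => y43.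
  apply: ler_of_sqr; first exact: sqr_ge0.
  rewrite -(ler_pM2r y_gt0); apply: le_trans x2y _.
  (* This product is [y^5 - (y^3 + y - 1)], the comparison of the two bounds on [x^2 y]. *)
  have : 0 <= (1 - y) * (1 - (y ^+ 4 + y ^+ 3)).
    by apply: mulr_ge0; lra.
  lra.
move=> xy2; split=> //.
have y43 := quartic_gt1 y0_gt0 yy0 y0E.
have : x ^+ 2 <= (y ^+ 2) ^+ 2.
  by rewrite ler_pXn2r // ?nnegrE ?sqr_ge0 // ltW.
move/(ler_wpM2r (ltW y_gt0)) => h.
apply: le_trans h _.
have : 0 <= (1 - y) * ((y ^+ 4 + y ^+ 3) - 1) by apply: mulr_ge0; lra.
lra.
Qed.

(** Cleared of denominators, [1 + y^2 - x^2 <= y / x] and [1 + y^2 - x^2 <= 1 / y]. *)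
Lemma regionP_ineq (y0 : R) x y : 0 < y0 -> y0 ^+ 4 + y0 ^+ 3 = 1 ->
  regionP y0 (x, y) -> x * (x + y) <= 1 /\ y ^+ 3 + y - 1 <= x ^+ 2 * y.
Proof.
move=> y0_gt0 y0E [[x0 xy y1 xy1] nLS].
have y_gt0 := lt_trans x0 xy.
have xPsi2 : x <= Psi2 y0 y by rewrite leNgt; apply/negP => h; apply: nLS; left.
have xPsi1 : Psi1 y0 y < x by rewrite ltNge; apply/negP => h; apply: nLS; right.
have two0 : 0 <= 2 :> R by [].
move: xPsi1 xPsi2; rewrite /Psi1 /Psi2.
case: ifP => [ys _ _|_].
  have y2 : 2 * y ^+ 2 <= 1.
    have : y ^+ 2 <= (Num.sqrt 2 / 2) ^+ 2.
      by rewrite ler_pXn2r // nnegrE ?(ltW y_gt0) // divr_ge0 // sqrtr_ge0.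
    by rewrite exprMn sqr_sqrtr //; lra.
  split; first by nra.
  (* The threshold comes from [(1 - y)^2 y - (y^3 + y - 1) = 1 - 2 y^2], together with
     [1 - y < x]. *)
  have : (1 - y) ^+ 2 <= x ^+ 2 by rewrite ler_pXn2r // ?nnegrE; lra.
  move/(ler_wpM2r (ltW y_gt0)); nra.
(* Above [y0] both bounds are [y^2], so the region is empty there. *)
have [yy0|yy0] := leP y y0; last first.
  by move=> y2x xy2; have := lt_le_trans y2x xy2; rewrite ltxx.
move=> Ex; rewrite leNgt Psi2_root // -leNgt => ->; split=> //.
rewrite -ler_pdivrMr //.
have [E0|E0] := leP ((y ^+ 3 + y - 1) / y) 0.
  by rewrite (le_trans E0) // sqr_ge0.
by rewrite -(sqr_sqrtr (ltW E0)) ler_pXn2r // ?nnegrE ?sqrtr_ge0 // ltW.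
Qed.
End Regions.

(** * The Euclidean plane: reflections across lines and triangles *)

Section Plane.
Variable R : realType.
Local Notation vec := 'rV[R]_2.
Implicit Types u v w a d e f g : vec.

Lemma dotE u v : dot u v = u 0 0 * v 0 0 + u 0 1 * v 0 1.
Proof.
rewrite /dot mxE big_ord_recl big_ord1 !mxE.
by congr (_ + u 0 _ * v 0 _); apply/val_inj.
Qed.

Lemma dotC u v : dot u v = dot v u.
Proof. by rewrite !dotE; ring. Qed.

Lemma dotDl u v w : dot (u + v) w = dot u w + dot v w.
Proof. by rewrite !dotE !mxE; ring. Qed.

Lemma dotBl u v w : dot (u - v) w = dot u w - dot v w.
Proof. by rewrite !dotE !mxE; ring. Qed.

Lemma dotZl k u w : dot (k *: u) w = k * dot u w.
Proof. by rewrite !dotE !mxE; ring. Qed.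

Lemma dotDr u v w : dot w (u + v) = dot w u + dot w v.
Proof. by rewrite !dotE !mxE; ring. Qed.

Lemma dotZr k u w : dot w (k *: u) = k * dot w u.
Proof. by rewrite !dotE !mxE; ring. Qed.

Lemma dotNl u w : dot (- u) w = - dot u w.
Proof. by rewrite !dotE !mxE; ring. Qed.

Lemma dotNr u w : dot w (- u) = - dot w u.
Proof. by rewrite !dotE !mxE; ring. Qed.

Definition dot_lin := (dotDl, dotNl, dotZl, dotDr, dotNr, dotZr).

Lemma dot_ge0 u : 0 <= dot u u.
Proof. by rewrite dotE -!expr2 addr_ge0 ?sqr_ge0. Qed.

Lemma rV2P u v : u 0 0 = v 0 0 -> u 0 1 = v 0 1 -> u = v.
Proof.
move=> h0 h1; apply/rowP => -[[|[|//]] i].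
- by rewrite (_ : Ordinal i = 0) //; apply/val_inj.
- by rewrite (_ : Ordinal i = 1) //; apply/val_inj.
Qed.

Lemma dot_eq0 u : dot u u = 0 -> u = 0.
Proof.
rewrite dotE -!expr2 => /eqP; rewrite paddr_eq0 ?sqr_ge0 // !sqrf_eq0.
by move=> /andP[/eqP h0 /eqP h1]; apply: rV2P; rewrite mxE.
Qed.

Lemma dot_gt0 u : u != 0 -> 0 < dot u u.
Proof.
move=> u0; rewrite lt_neqAle dot_ge0 andbT eq_sym.
by apply/negP => /eqP /dot_eq0 /eqP; apply/negP.
Qed.

Lemma enorm_ge0 u : 0 <= enorm u. Proof. exact: sqrtr_ge0. Qed.

Lemma sqr_enorm u : enorm u ^+ 2 = dot u u.
Proof. by rewrite sqr_sqrtr // dot_ge0. Qed.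

Lemma enorm_gt0 u : u != 0 -> 0 < enorm u.
Proof. by move=> u0; rewrite sqrtr_gt0 dot_gt0. Qed.

Lemma enormB u v : enorm (u - v) = enorm (v - u).
Proof. by rewrite /enorm !dot_lin (dotC v u); congr Num.sqrt; ring. Qed.

Definition rot90 u : vec := \row_j (if j == 0 then - u 0 1 else u 0 0).

Lemma rot90_0 u : rot90 u 0 0 = - u 0 1. Proof. by rewrite mxE. Qed.
Lemma rot90_1 u : rot90 u 0 1 = u 0 0. Proof. by rewrite mxE. Qed.
Definition rot90E := (rot90_0, rot90_1).

Lemma dot_rot90 u v : dot (rot90 u) (rot90 v) = dot u v.
Proof. by rewrite !dotE !rot90E; ring. Qed.

Lemma rot90K u : rot90 (rot90 u) = - u.
Proof. by apply: rV2P; rewrite !rot90E mxE. Qed.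

Lemma dot_rot90_self u : dot (rot90 u) u = 0.
Proof. by rewrite !dotE !rot90E; ring. Qed.

Lemma frame_expand u w : dot u u = 1 ->
  w = dot w u *: u + dot w (rot90 u) *: rot90 u.
Proof.
rewrite dotE => u1.
have combE k l v i : (k *: u + l *: v) 0 i = k * u 0 i + l * v 0 i.
  by rewrite !mxE.
by apply: rV2P; rewrite -[LHS]mulr1 -u1 combE !dotE !rot90E; ring.
Qed.

Lemma orthogonal_collinear u w : dot u u != 0 -> dot w u = 0 ->
  w = (dot w (rot90 u) / dot u u) *: rot90 u.
Proof.
move=> u0 wu.
have h i : dot w (rot90 u) * rot90 u 0 i = dot u u * w 0 i - dot w u * u 0 i.
  have [->|->] : i = 0 \/ i = 1.
  - by case: i => -[|[|//]] i; [left|right]; apply/val_inj.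
  - by rewrite !dotE !rot90E; ring.
  - by rewrite !dotE !rot90E; ring.
by apply/rowP => i; rewrite mxE mulrAC h wu mul0r subr0 mulrAC divff // mul1r.
Qed.

(** This replaces the choice operator in [proj] by a formula in a point and a normal [g], a quarter
    turn of a spanning vector of the direction. *)
Lemma reflection_line (U : set vec) : affine_subspace 1 U ->
  exists p g, [/\ 0 < dot g g, forall w, U w <-> dot (w - p) g = 0 &
    forall w, reflection U w = w - (2 * dot (w - p) g / dot g g) *: g].
Proof.
move=> [p [V [dimV UE]]].
set d := vpick V.
have d0 : d != 0 by rewrite vpick0 -dimv_eq0 dimV.
have VE : V = <[d]>%VS.
  by apply/eqP; rewrite eq_sym eqEdim dim_vline d0 dimV andbT -memvE memv_pick.
have g0 : 0 < dot (rot90 d) (rot90 d) by rewrite dot_rot90 dot_gt0.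
exists p, (rot90 d); set g := rot90 d in g0 *.
have UP w : U w <-> dot (w - p) g = 0.
  rewrite UE VE /=; split=> [/vlineP[k ->]|h].
    by rewrite dotZl dotC dot_rot90_self mulr0.
  apply/vlineP; exists (- (dot (w - p) (rot90 g) / dot g g)).
  rewrite {1}(@orthogonal_collinear g (w - p)) ?gt_eqF //.
  by rewrite scaleNr -scalerN /g rot90K.
split=> // w.
have n0 : dot g g != 0 by rewrite gt_eqF.
suff -> : reflection U w = 2 *: (w - (dot (w - p) g / dot g g) *: g) - w.
  by apply/rowP => i; rewrite !mxE; ring.
rewrite /reflection; congr (_ *: _ - _).
set m := w - _ *: g.
have mU : U m by apply/UP; rewrite /m !dot_lin; field.
have wm : w - m = (dot (w - p) g / dot g g) *: g by rewrite /m subKr.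
clearbody m.
apply: xget_unique.
  split=> // q /UP Uq; move/UP: mU => Um.
  rewrite wm.
  have -> : q - m = (q - p) - (m - p) by rewrite opprB addrA subrK.
  by rewrite dotZl (dotC g (_ - _)) (dotBl (q - p)) Uq Um subrr mulr0.
move=> m' [Um' m'P].
have h1 := m'P _ mU.
move/UP: mU => Um; move/UP: Um' => Um'.
apply/eqP; rewrite -subr_eq0; apply/eqP/dot_eq0.
(* Two feet of the perpendicular from [w] coincide: both summands vanish by orthogonality to the
   line. *)
have -> : dot (m' - m) (m' - m) = dot (w - m') (m - m') + dot (w - m) (m' - m).
  by rewrite !dot_lin (dotC m m'); ring.
rewrite h1 add0r.
rewrite wm.
have -> : m' - m = (m' - p) - (m - p) by rewrite opprB addrA subrK.
by rewrite dotZl (dotC g (_ - _)) (dotBl (m' - p)) Um Um' subrr mulr0.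
Qed.

Definition triangle_set A B C : set vec :=
  [set w | exists b c : R, [/\ 0 <= b, 0 <= c, b + c <= 1 &
    w = A + b *: (B - A) + c *: (C - A)]].

Lemma convex_hull3 A B C :
  convex_hull [set A; B; C] = triangle_set A B C.
Proof.
apply/seteqP; split.
  apply: smallest_sub => [u w l /set_mem uT /set_mem wT|w].
    have -> : conv l u w = l%:num *: (u : vec) + (1 - l%:num) *: (w : vec).
      by [].
    move: uT wT => [b [c [b0 c0 bc1 ->]]] [b' [c' [b'0 c'0 bc'1 ->]]].
    apply/mem_set.
    have l0 : 0 <= l%:num by [].
    have l1 : 0 <= 1 - l%:num by rewrite subr_ge0.
    exists (l%:num * b + (1 - l%:num) * b'), (l%:num * c + (1 - l%:num) * c').
    split.
    - nra.
    - nra.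
    - nra.
    by apply/rowP => i; rewrite !mxE; ring.
  move=> [[->|->]|->].
  - by exists 0, 0; rewrite !scale0r !addr0.
  - by exists 1, 0; rewrite !scale0r scale1r !addr0 addrC subrK; split.
  - by exists 0, 1; rewrite !scale0r scale1r !addr0 add0r addrC subrK; split.
move=> _ [b [c [b0 c0 bc1 ->]]] M [cM sM].
have MA : M A by apply: sM; left; left.
have MB : M B by apply: sM; left; right.
have MC : M C by apply: sM; right.
have cv (t : R) u w : 0 <= t -> t <= 1 -> M u -> M w ->
    M (t *: u + (1 - t) *: w).
  move=> t0 t1 /mem_set Mu /mem_set Mw.
  exact/set_mem/(cM u w (Itv01 t0 t1) Mu Mw).
(* If [b + c = 0] the point is [A]; otherwise it is a mixture of [A] with a point of the segment
   [BC]. *)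
have [bc0|bc0] := eqVneq (b + c) 0.
  have -> : b = 0 by lra.
  have -> : c = 0 by lra.
  by rewrite !scale0r !addr0.
have bc_gt0 : 0 < b + c by rewrite lt_neqAle eq_sym bc0 addr_ge0.
have := cv (b + c) _ _ (ltW bc_gt0) bc1
  (cv (b / (b + c)) B C (divr_ge0 b0 (ltW bc_gt0)) _ MB MC) MA.
suff -> : (b + c) *: (b / (b + c) *: B + (1 - b / (b + c)) *: C) +
    (1 - (b + c)) *: A = A + b *: (B - A) + c *: (C - A).
  by apply; rewrite ler_pdivrMr // mul1r lerDl.
by apply/rowP => i; rewrite !mxE; field.
Qed.

End Plane.

(* Admissible scaling factors in coordinates: the reflection has linear part
   [[c, s], [s, -c]] in the orthonormal frame [(e, f)], and [wA], [wB], [wC]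
   are barycentric coordinates of the translation part, scaled by [h] times
   the scaling factor. *)
Definition scaling_system (R : realFieldType) (p h c s wA wB wC : R) : Prop :=
  let q := 1 - p in
  [/\ [/\ 0 <= wC, - s <= wC & h * c - p * s <= wC],
      [/\ 0 <= wB, - (h * c) + p * s <= wB &
          - (2 * p * h) * c + (p ^+ 2 - h ^+ 2) * s <= wB] &
      [/\ 0 <= wA, h * c + q * s <= wA &
          (p - q) * h * c + (h ^+ 2 + p * q) * s <= wA]].

(** * Containment in a scaled reflected copy, in coordinates *)

Section Frame.
Variable R : realType.
Local Notation vec := 'rV[R]_2.
Variables (A e : vec) (p h : R).
Hypotheses (e1 : dot e e = 1) (h0 : 0 < h).
Variable f : vec.
Hypotheses (f1 : dot f f = 1) (ef : dot e f = 0)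
  (frameE : forall w : vec, w = dot w e *: e + dot w f *: f).

Let pt (X Y : R) : vec := A + X *: e + Y *: f.

Lemma triangle_frame w :
  triangle_set A (A + e) (A + p *: e + h *: f) w <->
  exists b c, [/\ 0 <= b, 0 <= c, b + c <= 1 & w = pt (b + p * c) (h * c)].
Proof.
have E b c : A + b *: (A + e - A) + c *: (A + p *: e + h *: f - A) =
    pt (b + p * c) (h * c).
  by apply/rowP => i; rewrite !mxE; ring.
by split=> -[b [c [b0 c0 bc ->]]]; exists b, c; split => //; rewrite E.
Qed.

Local Notation K := (triangle_set A (A + e) (A + p *: e + h *: f)).

Section Scaling.
Variables (rho : vec -> vec) (c s t1 t2 : R).
Hypothesis cs : c ^+ 2 + s ^+ 2 = 1.
Hypothesis rhoE : forall X Y,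
  rho (pt X Y) = pt (c * X + s * Y + t1) (s * X - c * Y + t2).

(** The linear part of [rho] is an involution, so containment means that the images of the vertices
    under it lie in a translate of [l K]. The system says that their barycentric coordinates are
    nonnegative; [t1] and [t2] are absorbed by [z]. *)
Lemma scaling_systemP l : 0 < l ->
  (exists z : vec, K `<=` [set z + l *: k | k in rho @` K]) <->
  (exists wA wB wC, scaling_system p h c s wA wB wC /\ wA + wB + wC = h * l).
Proof.
move=> l0; split.
  move=> [z sub].
  set X0 := dot (z - A + l *: A) e + l * t1.
  set Y0 := dot (z - A + l *: A) f + l * t2.
  set S1 := - (c * X0 + s * Y0); set S2 := - (s * X0 - c * Y0).
  (* The three quantities are [h l] times the barycentric coordinates, at [C], [B] and [A], of the
     point of [K] that is sent to [pt X Y]. *)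
  have key X Y : K (pt X Y) -> [/\ 0 <= s * X - c * Y + S2,
      0 <= h * (c * X + s * Y + S1) - p * (s * X - c * Y + S2) &
      0 <= h * l - h * (c * X + s * Y + S1) - (1 - p) * (s * X - c * Y + S2)].
    move=> /sub[_ [k /triangle_frame[b [d [b0 d0 bd ->]]] <-]].
    rewrite rhoE; set X' := c * _ + _ + t1; set Y' := s * _ - _ + t2 => E.
    have EX : X = X0 + l * (X' - t1).
      have := congr1 (fun w => dot w e) E.
      by rewrite /pt /X0 !dot_lin e1 (dotC f e) ef; lra.
    have EY : Y = Y0 + l * (Y' - t2).
      have := congr1 (fun w => dot w f) E.
      by rewrite /pt /Y0 !dot_lin f1 ef; lra.
    have -> : c * X + s * Y + S1 = l * (b + p * d).
      by rewrite EX EY /X' /Y' /S1 -[RHS]mulr1 -cs; ring.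
    have -> : s * X - c * Y + S2 = l * (h * d).
      by rewrite EX EY /X' /Y' /S2 -[RHS]mulr1 -cs; ring.
    have hl0 : 0 <= h * l by rewrite mulr_ge0 // ltW.
    have := mulr_ge0 hl0 b0; have := mulr_ge0 hl0 d0.
    have := ler_wpM2l hl0 bd => *.
    by split; lra.
  have KA : K (pt 0 0).
    by apply/triangle_frame; exists 0, 0; rewrite !mulr0 !addr0; split.
  have KB : K (pt 1 0).
    by apply/triangle_frame; exists 1, 0; rewrite !mulr0 !addr0; split.
  have KC : K (pt p h).
    by apply/triangle_frame; exists 0, 1; rewrite !mulr1 !add0r; split.
  move/key: KA => [A1 A2 A3]; move/key: KB => [B1 B2 B3].
  move/key: KC => [C1 C2 C3].
  exists (h * l - h * S1 - (1 - p) * S2), (h * S1 - p * S2), S2.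
  split; last by ring.
  by split; split; lra.
move=> [wA [wB [wC [[[C1 C2 C3] [B1 B2 B3] [A1 A2 A3]] wE]]]].
(* The translation [(S1, wC)] is recovered from its barycentric coordinates; [z] below is chosen to
   undo it, together with [t1], [t2] and the scaling of [A]. *)
set S1 := (wB + p * wC) / h.
have S1E : h * S1 = wB + p * wC by rewrite mulrC divfK // gt_eqF.
have hl : 0 < h * l by rewrite mulr_gt0.
have hl0 : h * l != 0 by rewrite gt_eqF.
have nh0 : h != 0 by rewrite gt_eqF.
have nl0 : l != 0 by rewrite gt_eqF.
exists (A - l *: A - (c * S1 + s * wC + l * t1) *: e
          - (s * S1 - c * wC + l * t2) *: f).
move=> w /triangle_frame[b [d [b0 d0 bd ->]]].
have a0 : 0 <= 1 - b - d by lra.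
set X := b + p * d; set Y := h * d.
exists (rho (pt ((c * X + s * Y + S1) / l) ((s * X - c * Y + wC) / l))).
  exists (pt ((c * X + s * Y + S1) / l) ((s * X - c * Y + wC) / l)) => //.
  apply/triangle_frame.
  exists ((h * (c * X + s * Y + S1) - p * (s * X - c * Y + wC)) / (h * l)).
  exists ((s * X - c * Y + wC) / (h * l)).
  (* For a general point of [K], the three vertex constraints are averaged with its weights
     [1 - b - d], [b], [d]; likewise for the other two coordinates. *)
  have wY : 0 <= s * X - c * Y + wC.
    move: C2 C3; rewrite -![_ <= wC]subr_ge0 => C2 C3.
    have := mulr_ge0 a0 C1; have := mulr_ge0 b0 C2; have := mulr_ge0 d0 C3.
    rewrite /X /Y; lra.
  split.
  - rewrite divr_ge0 ?(ltW hl) //.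
    move: B2 B3; rewrite -![_ <= wB]subr_ge0 => B2 B3; rewrite mulrDr S1E.
    have := mulr_ge0 a0 B1; have := mulr_ge0 b0 B2; have := mulr_ge0 d0 B3.
    rewrite /X /Y; lra.
  - exact: divr_ge0 wY (ltW hl).
  - rewrite -mulrDl ler_pdivrMr // mul1r.
    move: A2 A3; rewrite -![_ <= wA]subr_ge0 => A2 A3; rewrite mulrDr S1E.
    have := mulr_ge0 a0 A1; have := mulr_ge0 b0 A2; have := mulr_ge0 d0 A3.
    rewrite /X /Y; lra.
  - by congr pt; field; rewrite ?nh0 ?nl0.
rewrite rhoE /pt; set X' := (c * X + _ + _) / l; set Y' := (_ + wC) / l.
have EX : l * X' = c * X + s * Y + S1 by rewrite mulrC divfK.
have EY : l * Y' = s * X - c * Y + wC by rewrite mulrC divfK.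
clearbody X' Y'.
have EX' : X = - (c * S1 + s * wC + l * t1) + l * (c * X' + s * Y' + t1).
  rewrite !mulrDr !(mulrCA l) EX EY -[LHS]mulr1 -cs; ring.
have EY' : Y = - (s * S1 - c * wC + l * t2) + l * (s * X' - c * Y' + t2).
  rewrite !mulrDr mulrN !(mulrCA l) EX EY -[LHS]mulr1 -cs; ring.
rewrite [in RHS]EX' [in RHS]EY'.
by apply/rowP => i; rewrite !mxE; ring.
Qed.

Lemma circumradius_le r wA wB wC : 0 < r ->
  scaling_system p h c s wA wB wC -> wA + wB + wC = h * r ->
  circumradius K (rho @` K) <= r.
Proof.
move=> r0 sys wE; apply: ge_inf; first by exists 0 => l [/ltW].
by split=> //; apply/scaling_systemP => //; exists wA, wB, wC.
Qed.

Lemma circumradius_ge x y r : 1 / 2 < p -> p < 1 -> 0 < x -> x < y -> y < 1 ->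
  x ^+ 2 = (1 - p) ^+ 2 + h ^+ 2 -> y ^+ 2 = p ^+ 2 + h ^+ 2 ->
  0 <= r -> r * y <= 1 -> r * x <= y -> r <= 2 * p ->
  r <= circumradius K (rho @` K).
Proof.
move=> p2 p1 x0 xy y1 xE yE r0 rA rC rP; apply: lb_le_inf.
  (* The set of scaling factors must be nonempty: absolute values dominate all constraints, and the
     extra 1 in [wA + 1] makes the factor positive. *)
  pose wC := `|- s| + `|h * c - p * s|.
  pose wB := `|- (h * c) + p * s| +
    `|- (2 * p * h) * c + (p ^+ 2 - h ^+ 2) * s|.
  pose wA := `|h * c + (1 - p) * s| +
    `|(p - (1 - p)) * h * c + (h ^+ 2 + p * (1 - p)) * s|.
  have C0 : 0 <= wC by rewrite addr_ge0.
  have B0 : 0 <= wB by rewrite addr_ge0.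
  have A0 : 0 <= wA by rewrite addr_ge0.
  have l0 : 0 < (wA + 1 + wB + wC) / h by rewrite divr_gt0 //; lra.
  exists ((wA + 1 + wB + wC) / h); split=> //.
  apply/scaling_systemP => //; exists (wA + 1), wB, wC.
  split; last by rewrite mulrC divfK // gt_eqF.
  have le1 (u v : R) : u <= `|u| + `|v|.
    by rewrite (le_trans (ler_norm u)) // lerDl.
  have le2 (u v : R) : v <= `|u| + `|v|.
    by rewrite (le_trans (ler_norm v)) // lerDr.
  have A1 : wA <= wA + 1 by rewrite lerDl.
  split; split=> //; [exact: le1|exact: le2|exact: le1|exact: le2|..].
  - exact: le_trans A0 A1.
  - exact: le_trans (le1 _ _) A1.
  - exact: le_trans (le2 _ _) A1.
move=> l [l0 /scaling_systemP-/(_ l0)].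
move=> [wA [wB [wC [[[C1 C2 C3] [B1 B2 B3] [A1 A2 A3]] wE]]]].
have rE : (r <= l) = (r * h <= h * l) by rewrite mulrC ler_pM2l.
have pq : p + (1 - p) = 1 by ring.
have q0 : 0 < 1 - p by lra.
have qp : 1 - p < p by lra.
rewrite rE -wE.
(* Each of the six terms is a sum of one lower bound for each of [wA], [wB] and [wC]. *)
by have [ | | | [ | | ]] :=
  direction_lower_bound pq h0 q0 qp x0 xy y1 xE yE cs r0 rA rC rP; lra.
Qed.
End Scaling.

(** The linear part is the Householder matrix of the normal [g]: symmetric with trace 0 and
    determinant -1, hence of the form required by [rhoE]. *)
Lemma reflection_frame (U : set vec) : affine_subspace 1 U ->
  exists p0 g t1 t2, let n := dot g g in
    let c := 1 - 2 * dot g e ^+ 2 / n in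
    let s := - (2 * dot g e * dot g f) / n in
    [/\ 0 < n, n = dot g e ^+ 2 + dot g f ^+ 2,
      forall w, U w <-> dot (w - p0) g = 0, c ^+ 2 + s ^+ 2 = 1 &
      forall X Y, reflection U (pt X Y) =
        pt (c * X + s * Y + t1) (s * X - c * Y + t2)].
Proof.
move=> /reflection_line[p0 [g [n0 UP rE]]].
have nE : dot g g = dot g e ^+ 2 + dot g f ^+ 2.
  by rewrite {1}(frameE g) !dot_lin (dotC e) (dotC f); ring.
have nn : dot g g != 0 by rewrite gt_eqF.
exists p0, g, (- (2 * dot (A - p0) g / dot g g * dot g e)),
  (- (2 * dot (A - p0) g / dot g g * dot g f)).
split=> //.
  by move: nn; rewrite nE => nn; field.
move=> X Y; rewrite rE.
have -> : dot (pt X Y - p0) g = dot (A - p0) g + X * dot g e + Y * dot g f.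
  by rewrite /pt !dot_lin (dotC e) (dotC f); ring.
set k := 2 * dot (A - p0) g / dot g g.
have -> : 2 * (dot (A - p0) g + X * dot g e + Y * dot g f) / dot g g =
    k + 2 * (X * dot g e + Y * dot g f) / dot g g by rewrite /k; field.
have -> : k + 2 * (X * dot g e + Y * dot g f) / dot g g =
    k + 2 * (X * dot g e + Y * dot g f) / (dot g e ^+ 2 + dot g f ^+ 2).
  by rewrite nE.
rewrite nE; move: nn; rewrite nE.
move: (frameE g) k; move: (dot g e) (dot g f) => g1 g2 -> k nn.
rewrite /pt; apply/rowP => i; rewrite !mxE.
by field.
Qed.
End Frame.

(** * Coefficients and scaling factors for the three optimal axes *)

Section ReflectionCoefficients.
Variable R : realFieldType.

(* With [g] normal to the bisector of the directions [a] and [b] of equal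
   norm, the reflection maps [a] to [b], so that, in complex notation, its
   coefficient [c + i s] is [a * b / |a|^2]. *)
Lemma bisector_coefficients (a1 a2 b1 b2 N m g1 g2 : R) :
  a1 ^+ 2 + a2 ^+ 2 = N -> b1 ^+ 2 + b2 ^+ 2 = N ->
  a1 - b1 = m * g1 -> a2 - b2 = m * g2 -> a2 != b2 ->
  let n := g1 ^+ 2 + g2 ^+ 2 in 0 < n ->
  (1 - 2 * g1 ^+ 2 / n) * N = a1 * b1 - a2 * b2 /\
  - (2 * g1 * g2) / n * N = a1 * b2 + a2 * b1.
Proof.
move=> aN bN e1 e2 ab n n0.
have nn : n != 0 by rewrite gt_eqF.
have m0 : m != 0.
  by apply: contra_neq ab => m0; apply/eqP; rewrite -subr_eq0 e2 m0 mul0r.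
have mn : m ^+ 2 * n != 0 by rewrite mulf_neq0 // expf_neq0.
have nE : m ^+ 2 * n = (a1 - b1) ^+ 2 + (a2 - b2) ^+ 2.
  by rewrite e1 e2 /n; ring.
have k1 : 1 - 2 * g1 ^+ 2 / n =
    ((a2 - b2) ^+ 2 - (a1 - b1) ^+ 2) / (m ^+ 2 * n).
  by rewrite e1 e2; move: nn; rewrite /n => nn; field; rewrite m0 nn.
have k2 : - (2 * g1 * g2) / n = - (2 * (a1 - b1) * (a2 - b2)) / (m ^+ 2 * n).
  by rewrite e1 e2; move: nn; rewrite /n => nn; field; rewrite m0 nn.
rewrite k1 k2; split; rewrite mulrAC; apply: (canLR (mulfK mn)); rewrite nE.
  (* Grouped so that [N] becomes [|b|^2] beside squares of [a], [|a|^2] beside squares of [b], and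
     [N + N] becomes [|a|^2 + |b|^2]. *)
  transitivity ((a2 ^+ 2 - a1 ^+ 2) * N + (b2 ^+ 2 - b1 ^+ 2) * N
    - (a2 * b2 - a1 * b1) * (N + N)); first by ring.
  by rewrite -{1}bN -{1}aN -{1}aN -bN; ring.
transitivity (- (2 * a1 * a2) * N - (2 * b1 * b2) * N
    + (a1 * b2 + a2 * b1) * (N + N)); first by ring.
by rewrite -{1}bN -{1}aN -{1}aN -bN; ring.
Qed.

(** The reflection at the bisector at [A] is enlarged from [A] until the image of [AC], of length
    [y], covers [AB]. All weight is in [wA] because [A] is its own image. *)
Lemma scaling_smallest_bisector (p h y : R) :
  0 < p -> 0 < h -> 0 < y -> y < 1 ->
  y ^+ 2 = p ^+ 2 + h ^+ 2 -> scaling_system p h (p / y) (h / y) (h / y) 0 0.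
Proof.
move=> p0 h0 y0 y1 yE.
have yi : 0 < y^-1 by rewrite invr_gt0.
have hy : 0 < h / y by rewrite divr_gt0.
have yn : y != 0 by rewrite gt_eqF.
have y21 : y ^+ 2 < 1 by rewrite expr_lt1 // ltW.
split; split=> //.
- lra.
- by rewrite le_eqVlt; apply/orP; left; apply/eqP; ring.
- by rewrite le_eqVlt; apply/orP; left; apply/eqP; ring.
- have -> : - (2 * p * h) * (p / y) + (p ^+ 2 - h ^+ 2) * (h / y) =
      - (y ^+ 2 * (h / y)) by rewrite yE; ring.
  by rewrite oppr_le0 mulr_ge0 ?sqr_ge0 // ltW.
- exact: ltW.
- by rewrite le_eqVlt; apply/orP; left; apply/eqP; ring.
- have -> : (p - (1 - p)) * h * (p / y) + (h ^+ 2 + p * (1 - p)) * (h / y) =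
      y ^+ 2 * (h / y) by rewrite yE; ring.
  by rewrite ler_piMl // ltW.
Qed.

(** The image of [CB], of length [x], is enlarged from [C] until it covers [CA]. All weight is in
    [wB] because [A] is then the image of [B]. *)
Lemma scaling_largest_bisector (p h x y : R) : 1 / 2 < p -> p < 1 -> 0 < h ->
  0 < x -> 0 < y ->
  x ^+ 2 = (1 - p) ^+ 2 + h ^+ 2 -> y ^+ 2 = p ^+ 2 + h ^+ 2 ->
  scaling_system p h (- (p * (1 - p) + h ^+ 2) / (x * y))
    (h * (p - (1 - p)) / (x * y)) 0 (h * y / x) 0.
Proof.
move=> p2 p1 h0 x0 y0 xE yE.
have p0 : 0 < p by lra.
have q0 : 0 < 1 - p by lra.
have qp : 0 < p - (1 - p) by lra.
have xy0 : 0 < x * y by rewrite mulr_gt0.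
have xn : x != 0 by rewrite gt_eqF.
have yn : y != 0 by rewrite gt_eqF.
have s0 : 0 <= h * (p - (1 - p)) / (x * y).
  by rewrite !mulr_ge0 ?invr_ge0 // ltW.
have c0 : - (p * (1 - p) + h ^+ 2) / (x * y) <= 0.
  rewrite mulNr oppr_le0 divr_ge0 ?ltW //.
  by rewrite addr_gt0 ?mulr_gt0 // exprn_gt0.
have hyxE : h * y / x = h * (p ^+ 2 + h ^+ 2) / (x * y).
  by rewrite -yE; field; rewrite xn yn.
split; split=> //.
- lra.
- have := mulr_ge0_le0 (ltW h0) c0; have := mulr_ge0 (ltW p0) s0; lra.
- by rewrite !mulr_ge0 ?invr_ge0 // ltW.
- by rewrite hyxE le_eqVlt; apply/orP; left; apply/eqP; ring.
- by rewrite hyxE le_eqVlt; apply/orP; left; apply/eqP; ring.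
- have -> : h * (- (p * (1 - p) + h ^+ 2) / (x * y)) +
      (1 - p) * (h * (p - (1 - p)) / (x * y)) = - (x ^+ 2 * h / (x * y)).
    by rewrite xE; ring.
  by rewrite oppr_le0 !mulr_ge0 ?invr_ge0 // ltW.
- by rewrite le_eqVlt; apply/orP; left; apply/eqP; ring.
Qed.

(** The mirrored triangle is placed with the image of [B] at [A] and enlarged until the image of the
    edge [AC] passes through [C]; it then ends at distance [2 p] from [A] on the line [AB]. *)
Lemma scaling_perp_longest (p h : R) : 1 / 2 < p -> 0 < h ->
  scaling_system p h (-1) 0 0 (2 * p * h) 0.
Proof.
move=> p2 h0; have ph : 0 < (2 * p - 1) * h by rewrite mulr_gt0 //; lra.
by split; split=> //; lra.
Qed.
End ReflectionCoefficients.

(** * Angles, bisectors and interior points *)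

Section Angles.
Variable R : realType.
Local Notation vec := 'rV[R]_2.
Implicit Types (P Q V u w d : vec) (a b c : R).

Lemma dot_sqr_le u w : dot u w ^+ 2 <= dot u u * dot w w.
Proof.
rewrite -subr_ge0.
have -> : dot u u * dot w w - dot u w ^+ 2 = dot u (rot90 w) ^+ 2.
  by rewrite !dotE !rot90E; ring.
exact: sqr_ge0.
Qed.

Lemma cos_itv u w : dot u w / (enorm u * enorm w) \in `[-1, 1].
Proof.
have uw0 : 0 <= enorm u * enorm w by rewrite mulr_ge0 // enorm_ge0.
have [->|uw] := eqVneq (enorm u * enorm w) 0.
  by rewrite invr0 mulr0 in_itv /= lerN10 ler01.
have uw1 : 0 < enorm u * enorm w by rewrite lt_neqAle eq_sym uw.
have sq : (enorm u * enorm w) ^+ 2 = dot u u * dot w w.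
  by rewrite exprMn !sqr_enorm.
rewrite in_itv /= ler_pdivlMr // ler_pdivrMr // mulN1r mul1r lerNl.
apply/andP; split; apply: ler_of_sqr => //; rewrite ?sqrrN sq dot_sqr_le //.
Qed.

Lemma acos_le a b : a \in `[-1, 1] -> b \in `[-1, 1] ->
  (acos a <= acos b) = (b <= a).
Proof.
move=> ha hb; have pi_itv z : z \in `[-1, 1] -> acos z \in `[0, (pi : R)].
  by rewrite !in_itv /= => hz; rewrite acos_ge0 //= acos_lepi.
by rewrite !leNgt -ltr_cos ?pi_itv // !acosK.
Qed.

Lemma angleC P V Q : angle P V Q = angle Q V P.
Proof. by rewrite /angle dotC [enorm _ * _]mulrC. Qed.

Definition cosine_law a b c := (b ^+ 2 + c ^+ 2 - a ^+ 2) / (2 * b * c).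

Lemma cosine_lawC a b c : cosine_law a b c = cosine_law a c b.
Proof. by rewrite /cosine_law [b ^+ 2 + _]addrC mulrAC. Qed.

Lemma dot_sides P V Q :
  2 * dot (P - V) (Q - V) =
  enorm (P - V) ^+ 2 + enorm (Q - V) ^+ 2 - enorm (P - Q) ^+ 2.
Proof.
by rewrite !sqr_enorm !dot_lin (dotC V P) (dotC V Q) (dotC Q P); ring.
Qed.

Lemma dot_cosine_law P V Q :
  dot (P - V) (Q - V) / (enorm (P - V) * enorm (Q - V)) =
  cosine_law (enorm (P - Q)) (enorm (P - V)) (enorm (Q - V)).
Proof.
rewrite /cosine_law -dot_sides -[2 * _ * enorm (Q - V)]mulrA.
by rewrite -mulf_div mulfV ?mul1r.
Qed.

(** Equal angles have equal cosines, and cancelling the length of [w - V] leaves a linear condition.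
    Its normal is the difference of the two sides rescaled to a common length. *)
Lemma bisector_normal P V Q w : w != V -> P != V -> Q != V ->
  angle P V w = angle w V Q ->
  dot (w - V) (enorm (Q - V) *: (P - V) - enorm (P - V) *: (Q - V)) = 0.
Proof.
rewrite -(subr_eq0 w) -(subr_eq0 P) -(subr_eq0 Q) => w0 P0 Q0 /eqP.
rewrite eq_le !acos_le ?cos_itv //.
rewrite -eq_le => /eqP.
have := enorm_gt0 w0; have := enorm_gt0 P0; have := enorm_gt0 Q0.
set dw := w - V; set dP := P - V; set dQ := Q - V => Qp Pp wp E.
clearbody dw dP dQ; rewrite !dot_lin (dotC dw dP).
have wn : enorm dw != 0 by rewrite gt_eqF.
have Pn : enorm dP != 0 by rewrite gt_eqF.
have Qn : enorm dQ != 0 by rewrite gt_eqF.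
have -> : dot dP dw = dot dP dw / (enorm dP * enorm dw) * (enorm dP * enorm dw).
  by rewrite mulfVK // mulf_neq0.
rewrite -E; field; by rewrite wn Qn.
Qed.

(** The normal [n] to [VP], turned towards [Q], gives a linear form that is nonnegative on the
    triangle and 0 at [V], so [V - t n] leaves the triangle for every [t > 0]. *)
Lemma vertex_not_interior V P Q :
  dot (Q - V) (rot90 (P - V)) != 0 -> ~ interior (triangle_set V P Q) V.
Proof.
move=> c0 VK.
set n := dot (Q - V) (rot90 (P - V)) *: rot90 (P - V).
have Pn : dot (P - V) n = 0.
  by rewrite dotZr (dotC (P - V)) dot_rot90_self mulr0.
have Qn : 0 <= dot (Q - V) n by rewrite dotZr -expr2 sqr_ge0.
have n0 : 0 < dot n n.
  apply: dot_gt0; apply: contra_neq c0 => n0.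
  have : dot (Q - V) n = 0 by rewrite n0 dotE !mxE !mulr0 addr0.
  by rewrite dotZr -expr2 => /eqP; rewrite sqrf_eq0 => /eqP.
clearbody n.
have cvg : (fun t : R => V - t *: n) @ (0 : R) --> V.
  rewrite -[X in _ --> X](_ : V - (0 : R) *: n = V); last first.
    by rewrite scale0r subr0.
  apply: cvgB; first exact: cvg_cst.
  by apply: cvgZr_tmp; exact: cvg_id.
have /= near0 := cvg _ VK.
have [t [t0 [b [c [b0 c0' _ E]]]]] :
    exists t : R, 0 < t /\ triangle_set V P Q (V - t *: n).
  have /nbhs_ballP[r /= r0 ballr] := near0.
  exists (r / 2); split; first by rewrite divr_gt0.
  apply: ballr; rewrite -ball_normE /= sub0r normrN gtr0_norm ?divr_gt0 //.
  by rewrite ltr_pdivrMr // mulr_natr mulr2n ltrDl.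
have := congr1 (fun w => dot (w - V) n) E.
have -> : V - t *: n - V = - (t *: n) by rewrite [LHS]addrC addKr.
have -> : V + b *: (P - V) + c *: (Q - V) - V = b *: (P - V) + c *: (Q - V).
  by apply/rowP => i; rewrite !mxE; ring.
rewrite dotNl dotZl dotDl !dotZl Pn mulr0 add0r => E'.
have := mulr_gt0 t0 n0; have := mulr_ge0 c0' Qn; lra.
Qed.

End Angles.

(** * Lower and upper bounds for the triangle with sides [x], [y] and 1 *)

Section Triangle.
Variable R : realType.
Local Notation vec := 'rV[R]_2.

Lemma chirality_attained (K U : set vec) (m : R) : affine_subspace 1 U ->
  (forall V, affine_subspace 1 V -> m <= circumradius K (reflection V @` K)) ->
  circumradius K (reflection U @` K) <= m ->
  chirality1 K = circumradius K (reflection U @` K).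
Proof.
move=> affU lb ub; apply/eqP; rewrite eq_le; apply/andP; split.
  apply: ge_inf; last by exists U.
  by exists m => _ [V affV <-]; exact: lb.
apply: (le_trans ub); apply: lb_le_inf; first by eexists; exists U.
by move=> _ [V affV <-]; exact: lb.
Qed.

(** The triangle may have either orientation, so [f] is a quarter turn of [e] or its opposite,
    whichever gives [C] the coordinate [h]. *)
Lemma frame_exists (A e C : vec) (p h : R) : dot e e = 1 ->
  dot (C - A) e = p -> dot (C - A) (C - A) = p ^+ 2 + h ^+ 2 ->
  exists f : vec, [/\ dot f f = 1, dot e f = 0,
    forall w, w = dot w e *: e + dot w f *: f & C = A + p *: e + h *: f].
Proof.
move=> e1 Cp Ch.
set k := dot (C - A) (rot90 e).
have CE : C - A = p *: e + k *: rot90 e.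
  by rewrite {1}(frame_expand (C - A) e1) Cp.
have r1 : dot (rot90 e) (rot90 e) = 1 by rewrite dot_rot90.
have er : dot e (rot90 e) = 0 by rewrite dotC dot_rot90_self.
have : k ^+ 2 = h ^+ 2.
  apply: (addrI (p ^+ 2)); rewrite -Ch CE; clearbody k.
  by rewrite !dot_lin e1 r1 (dotC (rot90 e)) er; ring.
have C_A : C = A + (C - A) by rewrite addrC subrK.
move/eqP; rewrite eqf_sqr => /orP[/eqP kh|/eqP kh].
  exists (rot90 e); split=> //; first by move=> w; exact: frame_expand.
  by rewrite {1}C_A CE kh addrA.
exists (- rot90 e); split.
- by rewrite dotNl dotNr opprK.
- by rewrite dotNr er oppr0.
- by move=> w; rewrite dotNr scalerN scaleNr opprK; exact: frame_expand.
- by rewrite {1}C_A CE kh scalerN scaleNr addrA.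
Qed.

Lemma orthogonal_proportional (d g a : vec) : d != 0 -> 0 < dot g g ->
  dot d g = 0 -> dot d a = 0 -> exists m, a = m *: g.
Proof.
move=> d0 g0 dg da; have dn : dot d d != 0 by rewrite gt_eqF // dot_gt0.
rewrite dotC in dg; rewrite dotC in da.
have := orthogonal_collinear dn dg; set k := _ / _ => gE.
have := orthogonal_collinear dn da; set l := _ / _ => aE.
have k0 : k != 0.
  apply: contraTneq g0 => k0.
  by rewrite gE k0 scale0r dotE !mxE !mul0r addr0 ltxx.
by exists (l / k); rewrite aE gE scalerA divfK.
Qed.

Lemma triangle_parameters (x y : R) :
  0 < x -> x < y -> y < 1 -> 1 < x + y ->
  exists p h : R, [/\ 1 / 2 < p, p < 1, 0 < h,
    x ^+ 2 = (1 - p) ^+ 2 + h ^+ 2 & y ^+ 2 = p ^+ 2 + h ^+ 2].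
Proof.
move=> x0 xy y1 xy1; have y0 := lt_trans x0 xy.
(* The squared altitude, factored as in Heron's formula; the foot [p] comes from the law of
   cosines. *)
have heron : 0 < y ^+ 2 - ((1 + y ^+ 2 - x ^+ 2) / 2) ^+ 2.
  have -> : y ^+ 2 - ((1 + y ^+ 2 - x ^+ 2) / 2) ^+ 2 =
    (x - (1 - y)) * (x + (1 - y)) * ((1 + y - x) * (1 + y + x)) / 4 by field.
  by rewrite divr_gt0 // !mulr_gt0 //; lra.
exists ((1 + y ^+ 2 - x ^+ 2) / 2).
exists (Num.sqrt (y ^+ 2 - ((1 + y ^+ 2 - x ^+ 2) / 2) ^+ 2)).
have xy2 : x ^+ 2 < y ^+ 2 by rewrite ltr_pXn2r // nnegrE ltW.
have y21 : y ^+ 2 < 1 by rewrite expr_lt1 // ltW.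
have x2 : 0 < x ^+ 2 by rewrite exprn_gt0.
split; first lra.
- lra.
- by rewrite sqrtr_gt0.
- by rewrite sqr_sqrtr ?ltW //; field.
- by rewrite sqr_sqrtr ?ltW // addrC subrK.
Qed.

Variables (A B C e : vec) (x y p h : R).
Hypothesis BAe : B - A = e.
Hypotheses (x0 : 0 < x) (xy : x < y) (y1 : y < 1).
Hypotheses (BC : enorm (B - C) = x) (AC : enorm (A - C) = y)
  (AB : enorm (A - B) = 1).
Hypotheses (p2 : 1 / 2 < p) (p1 : p < 1) (h0 : 0 < h)
  (xE : x ^+ 2 = (1 - p) ^+ 2 + h ^+ 2) (yE : y ^+ 2 = p ^+ 2 + h ^+ 2).

Local Notation K := (triangle_set A B C).

Let y0 : 0 < y. Proof. exact: lt_trans xy. Qed.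

Let p_gt0 : 0 < p. Proof. by apply: lt_trans p2; rewrite divr_gt0. Qed.

Let pE : 2 * p = 1 + y ^+ 2 - x ^+ 2.
Proof. by rewrite xE yE; ring. Qed.

Let e1 : dot e e = 1.
Proof. by rewrite -sqr_enorm -BAe enormB AB expr1n. Qed.

Let frame : exists f : vec, [/\ dot f f = 1, dot e f = 0,
    forall w, w = dot w e *: e + dot w f *: f & C = A + p *: e + h *: f].
Proof.
have CA : dot (C - A) (C - A) = y ^+ 2 by rewrite -sqr_enorm enormB AC.
apply: frame_exists => //; last by rewrite CA yE.
rewrite -BAe; have := dot_sides C A B.
rewrite (enormB C) (enormB B A) (enormB C B) AC AB BC expr1n; move: pE; lra.
Qed.

Let KE f : C = A + p *: e + h *: f ->
  K = triangle_set A (A + e) (A + p *: e + h *: f).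
Proof. by move=> <-; congr triangle_set; rewrite -BAe addrC subrK. Qed.

(** The conditions say that [r] is at most [1 / y], [y / x] and [1 + y^2 - x^2]; in each region one
    of these three is the minimum. *)
Lemma chirality_lower_bound r U : affine_subspace 1 U ->
  0 <= r -> r * y <= 1 -> r * x <= y -> r <= 1 + y ^+ 2 - x ^+ 2 ->
  r <= circumradius K (reflection U @` K).
Proof.
move=> affU r0 rA rC rP; have [f [f1 ef fE CE]] := frame.
have [p0 [g [t1 [t2 [_ _ _ cs rE]]]]] := reflection_frame A fE affU.
rewrite (KE CE).
apply: (circumradius_ge e1 h0 f1 ef cs rE p2 p1 x0 xy y1 xE yE) => //.
by apply: (le_trans rP); rewrite pE.
Qed.

Lemma perp_longest_upper_bound U : affine_subspace 1 U ->
  (forall u w, U u -> U w -> dot (u - w) (A - B) = 0) ->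
  circumradius K (reflection U @` K) <= 1 + y ^+ 2 - x ^+ 2.
Proof.
move=> affU perp; have [f [f1 ef fE CE]] := frame.
have [p0 [g [t1 [t2]]]] := reflection_frame A fE affU.
move=> /= [n0 nE UP cs rE].
have g2 : dot g f = 0.
  have U1 : U p0 by apply/UP; rewrite subrr dotE !mxE !mul0r addr0.
  (* A second point of the line, displaced by a quarter turn of [g], turns perpendicularity to [AB]
     into a condition on [g]. *)
  have U2 : U (p0 + (- dot g f *: e + dot g e *: f)).
    apply/UP; rewrite addrC addKr dotDl !dotZl (dotC e) (dotC f); ring.
  have := perp _ _ U2 U1; rewrite [p0 + _]addrC addrK.
  have -> : A - B = - e by rewrite -BAe opprB.
  rewrite dotNr dotDl !dotZl e1 (dotC f e) ef; lra.
have g1 : dot g e ^+ 2 != 0.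
  by apply: contraTneq n0 => g1; rewrite nE g1 g2 expr0n addr0 ltxx.
have cE : 1 - 2 * dot g e ^+ 2 / dot g g = -1.
  by rewrite nE g2; move: g1 => g1; field; rewrite -sqrf_eq0.
have sE : - (2 * dot g e * dot g f) / dot g g = 0.
  by rewrite g2 mulr0 oppr0 mul0r.
have r0 : 0 < 1 + y ^+ 2 - x ^+ 2 by rewrite -pE; move: p2; lra.
rewrite (KE CE).
apply: (circumradius_le e1 h0 f1 ef cs rE r0
  (wA := 0) (wB := 2 * p * h) (wC := 0)).
  by rewrite cE sE; exact: scaling_perp_longest.
by rewrite -pE; ring.
Qed.

Lemma largest_bisector_upper_bound U w : affine_subspace 1 U ->
  U C -> U w -> w != C -> dot (w - C) (x *: (A - C) - y *: (B - C)) = 0 ->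
  circumradius K (reflection U @` K) <= y / x.
Proof.
move=> affU UC Uw wC wd; have [f [f1 ef fE CE]] := frame.
have [p0 [g [t1 [t2]]]] := reflection_frame A fE affU.
move=> /= [n0 nE UP cs rE].
have dg : dot (w - C) g = 0.
  have -> : w - C = (w - p0) - (C - p0) by rewrite opprB addrA subrK.
  by rewrite dotBl (UP w).1 // (UP C).1 // subrr.
have d0 : w - C != 0 by rewrite subr_eq0.
have [m mE] := orthogonal_proportional d0 n0 dg wd.
have AE : A - C = - p *: e - h *: f.
  by rewrite CE; apply/rowP => i; rewrite !mxE; ring.
have BCE : B - C = (1 - p) *: e - h *: f.
  have -> : B = A + e by rewrite -BAe addrC subrK.
  by rewrite CE; apply/rowP => i; rewrite !mxE; ring.
(* The sides [A - C] and [B - C] are rescaled to the common length [x y]; their difference is a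
   multiple of [g]. *)
have m1 : x * - p - y * (1 - p) = m * dot g e.
  by rewrite -dotZl -mE AE BCE !dot_lin e1 (dotC f e) ef; ring.
have m2 : x * - h - y * - h = m * dot g f.
  by rewrite -dotZl -mE AE BCE !dot_lin f1 ef; ring.
have aN : (x * - p) ^+ 2 + (x * - h) ^+ 2 = (x * y) ^+ 2.
  by rewrite [RHS]exprMn yE; ring.
have bN : (y * (1 - p)) ^+ 2 + (y * - h) ^+ 2 = (x * y) ^+ 2.
  by rewrite [RHS]exprMn xE; ring.
have ab : x * - h != y * - h.
  have hn : - h != 0 by rewrite oppr_eq0 gt_eqF.
  by rewrite (inj_eq (mulIf hn)) lt_eqF.
have xyn : (x * y) ^+ 2 != 0 by rewrite expf_neq0 // mulf_neq0 // gt_eqF.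
have xn : x != 0 by rewrite gt_eqF.
have yn : y != 0 by rewrite gt_eqF.
have n0' : 0 < dot g e ^+ 2 + dot g f ^+ 2 by rewrite -nE.
have [cE sE] := bisector_coefficients aN bN m1 m2 ab n0'.
rewrite -nE in cE sE.
have {}cE : 1 - 2 * dot g e ^+ 2 / dot g g =
    - (p * (1 - p) + h ^+ 2) / (x * y).
  by apply: (mulIf xyn); rewrite cE; field; rewrite xn yn.
have {}sE : - (2 * dot g e * dot g f) / dot g g =
    h * (p - (1 - p)) / (x * y).
  by apply: (mulIf xyn); rewrite sE; field; rewrite xn yn.
have r0 : 0 < y / x by rewrite divr_gt0.
rewrite (KE CE).
apply: (circumradius_le e1 h0 f1 ef cs rE r0
  (wA := 0) (wB := h * y / x) (wC := 0)).
  by rewrite cE sE; exact: scaling_largest_bisector.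
by rewrite add0r addr0 mulrA.
Qed.

Lemma smallest_bisector_upper_bound U w : affine_subspace 1 U ->
  U A -> U w -> w != A -> dot (w - A) (y *: (B - A) - (C - A)) = 0 ->
  circumradius K (reflection U @` K) <= 1 / y.
Proof.
move=> affU UA Uw wA wd; have [f [f1 ef fE CE]] := frame.
have [p0 [g [t1 [t2]]]] := reflection_frame A fE affU.
move=> /= [n0 nE UP cs rE].
have dg : dot (w - A) g = 0.
  have -> : w - A = (w - p0) - (A - p0) by rewrite opprB addrA subrK.
  by rewrite dotBl (UP w).1 // (UP A).1 // subrr.
have d0 : w - A != 0 by rewrite subr_eq0.
have [m mE] := orthogonal_proportional d0 n0 dg wd.
have CAE : C - A = p *: e + h *: f.
  by rewrite {1}CE; apply/rowP => i; rewrite !mxE; ring.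
(* Here the common length is [y]: only [B - A] is rescaled. *)
have m1 : y - p = m * dot g e.
  by rewrite -dotZl -mE BAe CAE !dot_lin e1 (dotC f e) ef; ring.
have m2 : 0 - h = m * dot g f.
  by rewrite -dotZl -mE BAe CAE !dot_lin f1 ef; ring.
have aN : y ^+ 2 + 0 ^+ 2 = y ^+ 2 by rewrite expr0n addr0.
have ab : 0 != h by rewrite lt_eqF.
have yn2 : y ^+ 2 != 0 by rewrite expf_neq0 // gt_eqF.
have yn : y != 0 by rewrite gt_eqF.
have n0' : 0 < dot g e ^+ 2 + dot g f ^+ 2 by rewrite -nE.
have [cE sE] := bisector_coefficients aN (esym yE) m1 m2 ab n0'.
rewrite -nE in cE sE.
have {}cE : 1 - 2 * dot g e ^+ 2 / dot g g = p / y.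
  by apply: (mulIf yn2); rewrite cE; field; rewrite yn.
have {}sE : - (2 * dot g e * dot g f) / dot g g = h / y.
  by apply: (mulIf yn2); rewrite sE; field; rewrite yn.
have r0 : 0 < 1 / y by rewrite divr_gt0.
rewrite (KE CE).
apply: (circumradius_le e1 h0 f1 ef cs rE r0 (wA := h / y) (wB := 0) (wC := 0)).
  by rewrite cE sE; exact: scaling_smallest_bisector.
by rewrite !addr0 mul1r.
Qed.

Lemma cross_neq0 : dot (C - A) (rot90 (B - A)) != 0.
Proof.
have [f [f1 ef fE CE]] := frame.
have CAE : C - A = p *: e + h *: f.
  by rewrite {1}CE; apply/rowP => i; rewrite !mxE; ring.
rewrite -sqrf_eq0 gt_eqF // BAe.
have -> : dot (C - A) (rot90 e) ^+ 2 =
   dot (C - A) (C - A) * dot e e - dot (C - A) e ^+ 2.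
  by rewrite !dotE !rot90E; ring.
rewrite e1 mulr1 CAE !dot_lin e1 (dotC f e) ef f1.
have : 0 < h ^+ 2 by rewrite exprn_gt0.
lra.
Qed.

End Triangle.

(** * Independence of the cyclic labelling of the vertices *)

Section Vertices.
Variables (R : realType) (v : 'I_3 -> 'rV[R]_2).
Implicit Types i j k : 'I_3.

(** The side lengths are known only up to a permutation, so the three labels may follow the cyclic
    order modulo 3 or reverse it. *)
Lemma other_indices i j k : i != j -> i != k -> j != k ->
  (i + 1 = j /\ i + 2 = k) \/ (i + 1 = k /\ i + 2 = j).
Proof.
by case: i j k => [[|[|[|//]]] ?] [[|[|[|//]]] ?] [[|[|[|//]]] ?] // _ _ _;
  by [left; split; apply/val_inj | right; split; apply/val_inj].
Qed.

Lemma index_cases i j k l : i != j -> i != k -> j != k ->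
  [\/ l = i, l = j | l = k].
Proof.
by case: i j k l =>
  [[|[|[|//]]] ?] [[|[|[|//]]] ?] [[|[|[|//]]] ?] [[|[|[|//]]] ?] // _ _ _;
  by [apply: Or31; apply/val_inj | apply: Or32; apply/val_inj |
      apply: Or33; apply/val_inj].
Qed.

Variables i j k : 'I_3.
Hypotheses (ij : i != j) (ik : i != k) (jk : j != k).

Lemma side_lengthE : side_length v i = enorm (v j - v k).
Proof.
by case: (other_indices ij ik jk) => -[ei ej];
  rewrite /side_length ei ej // enormB.
Qed.

Lemma interior_angleE : interior_angle v i = angle (v j) (v i) (v k).
Proof.
by case: (other_indices ij ik jk) => -[ei ej];
  rewrite /interior_angle ei ej // angleC.
Qed.

Lemma range_vertices : range v = [set v i; v j; v k].
Proof.
apply/seteqP; split=> [_ [l _ <-]|w].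
  by case: (index_cases l ij ik jk) => ->; [left; left|left; right|right].
by case=> [[->|->]|->]; eexists.
Qed.

Lemma angle_bisectorE (K U : set 'rV[R]_2) : is_angle_bisector v K i U ->
  K = triangle_set (v i) (v j) (v k) ->
  dot (v k - v i) (rot90 (v j - v i)) != 0 ->
  exists w, [/\ affine_subspace 1 U, U (v i), U w, w != v i &
    dot (w - v i) (enorm (v k - v i) *: (v j - v i) -
                   enorm (v j - v i) *: (v k - v i)) = 0].
Proof.
move=> [affU Ui [w [Uw Kw]] bis] KE cross; exists w.
have wi : w != v i.
  apply/eqP => wi; apply: (vertex_not_interior cross).
  by move: Kw; rewrite wi KE.
have ji : v j != v i.
  apply: contra_neq cross => ji; rewrite ji subrr dotE !rot90E !mxE; ring.
have ki : v k != v i.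
  by apply: contra_neq cross => ki; rewrite ki subrr dotE !mxE !mul0r addr0.
split=> //; apply: bisector_normal => //.
have := bis w (conj Uw Kw).
case: (other_indices ij ik jk) => -[-> ->] // E.
by rewrite angleC -E angleC.
Qed.

End Vertices.

(** * Comparison of angles, and the final case analysis *)

Lemma cosine_law_lt (R : realType) (a b c : R) :
  0 < a -> a < b -> 0 < c -> c < a + b -> cosine_law b a c < cosine_law a b c.
Proof.
move=> a0 ab c0 cab; have b0 := lt_trans a0 ab.
rewrite -subr_gt0.
have -> : cosine_law a b c - cosine_law b a c =
    (b - a) * ((a + b - c) * (a + b + c)) / (2 * a * b * c).
  by rewrite /cosine_law; field; rewrite !gt_eqF.
rewrite divr_gt0 // !mulr_gt0 //; lra.
Qed.

Lemma interior_angle_gt (R : realType) (v : 'I_3 -> 'rV[R]_2) (i j k : 'I_3) :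
  i != j -> i != k -> j != k ->
  0 < side_length v i -> side_length v i < side_length v j ->
  0 < side_length v k -> side_length v k < side_length v i + side_length v j ->
  interior_angle v i < interior_angle v j.
Proof.
move=> ij ik jk si sij sk tri.
have ji : j != i by rewrite eq_sym.
have ki : k != i by rewrite eq_sym.
have kj : k != j by rewrite eq_sym.
rewrite ltNge (interior_angleE v ij ik jk) (interior_angleE v ji jk ik).
rewrite acos_le ?cos_itv // !dot_cosine_law -ltNge.
rewrite -(side_lengthE v ij ik jk) -(side_lengthE v ji jk ik).
rewrite (enormB (v k)) (enormB (v k)) (enormB (v j) (v i)).
rewrite -(side_lengthE v ki kj ij) -(side_lengthE v ij ik jk).
rewrite -(side_lengthE v ji jk ik) !(cosine_lawC _ (side_length v k)).
exact: cosine_law_lt.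
Qed.

Theorem corollary6p5 (R : realType) (v : 'I_3 -> 'rV[R]_2) (K : set 'rV[R]_2)
    (x y y0 : R)
    (hK : is_triangle v K)
    (hsides : perm_eq [seq side_length v i | i : 'I_3] [:: x; y; 1])
    (hx : 0 < x) (hxy : x < y) (hy : y < 1) (hxy1 : 1 < x + y)
    (hy0 : 0 < y0) (hy0_eq : y0 ^+ 4 + y0 ^+ 3 = 1) :
  [/\ regionL y0 (x, y) -> forall U : set 'rV[R]_2,
        bisects_largest_angle v K U ->
        chirality1 K = circumradius K (reflection U @` K),
      regionS y0 (x, y) -> forall U : set 'rV[R]_2,
        bisects_smallest_angle v K U ->
        chirality1 K = circumradius K (reflection U @` K)
    & regionP y0 (x, y) -> forall U : set 'rV[R]_2,
        perp_longest_edge v U ->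
        chirality1 K = circumradius K (reflection U @` K)].
Proof.
have sideP z : z \in [:: x; y; 1] -> exists i, side_length v i = z.
  by rewrite -(perm_mem hsides) => /mapP[i _ ->]; exists i.
(* Each vertex is named after the opposite side: [iA], [iB], [iC] face the sides [x], [y] and 1. *)
have [iA sA] : exists i, side_length v i = x by apply: sideP; rewrite !inE eqxx.
have [iB sB] : exists i, side_length v i = y.
  by apply: sideP; rewrite !inE eqxx orbT.
have [iC sC] : exists i, side_length v i = 1.
  by apply: sideP; rewrite !inE eqxx !orbT.
have AB : iA != iB.
  by apply: contraTneq hxy => E; rewrite -sA -sB E ltxx.
have AC : iA != iC.
  by apply: contraTneq (lt_trans hxy hy) => E; rewrite -sA -sC E ltxx.
have BC : iB != iC.
  by apply: contraTneq hy => E; rewrite -sB -sC E ltxx.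
have BA : iB != iA by rewrite eq_sym.
have CA : iC != iA by rewrite eq_sym.
have CB : iC != iB by rewrite eq_sym.
have y_gt0 := lt_trans hx hxy.
have x1 := lt_trans hxy hy.
have KE : K = triangle_set (v iA) (v iB) (v iC).
  by rewrite hK.2 (range_vertices v AB AC BC) convex_hull3.
have eBC : enorm (v iB - v iC) = x by rewrite -(side_lengthE v AB AC BC).
have eAC : enorm (v iA - v iC) = y by rewrite -(side_lengthE v BA BC AC).
have eAB : enorm (v iA - v iB) = 1 by rewrite -(side_lengthE v CA CB AB).
have [p [h [p2 p1 h0 xE yE]]] := triangle_parameters hx hxy hy hxy1.
have lower r U (affU : affine_subspace 1 U) : 0 <= r -> r * y <= 1 ->
    r * x <= y -> r <= 1 + y ^+ 2 - x ^+ 2 ->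
    r <= circumradius K (reflection U @` K).
  rewrite KE; exact: (chirality_lower_bound (erefl _) hx hxy hy eBC eAC eAB
    p2 p1 h0 xE yE affU).
have x2 : 0 < x ^+ 2 by rewrite exprn_gt0.
have y2 : 0 < y ^+ 2 by rewrite exprn_gt0.
have y21 : y ^+ 2 < 1 by rewrite expr_lt1 // ltW.
have xy2 : x ^+ 2 < y ^+ 2 by rewrite ltr_pXn2r // nnegrE ltW.
have angAC : interior_angle v iA < interior_angle v iC.
  by apply: (interior_angle_gt AC AB CB); rewrite ?sA ?sB ?sC; lra.
have angBC : interior_angle v iB < interior_angle v iC.
  by apply: (interior_angle_gt BC BA CA); rewrite ?sA ?sB ?sC; lra.
have angAB : interior_angle v iA < interior_angle v iB.
  by apply: (interior_angle_gt AB AC BC); rewrite ?sA ?sB ?sC; lra.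
have crossA : dot (v iC - v iA) (rot90 (v iB - v iA)) != 0.
  exact: (cross_neq0 (erefl _) eBC eAC eAB h0 xE yE).
have crossC : dot (v iB - v iC) (rot90 (v iA - v iC)) != 0.
  by move: crossA; congr (_ != 0); rewrite !dotE !rot90E !mxE; ring.
have eCA : enorm (v iC - v iA) = y by rewrite enormB.
have eBA : enorm (v iB - v iA) = 1 by rewrite enormB.
split.
- move=> /(regionL_ineq hy0 hy0_eq)[y2x xyx] U [i [imax bis]].
  have iE : i = iC.
    have [iE|iE|//] := index_cases i AB AC BC.
      by have := imax iC; rewrite iE leNgt angAC.
    by have := imax iC; rewrite iE leNgt angBC.
  rewrite iE in bis.
  have KE' : K = triangle_set (v iC) (v iA) (v iB).
    by rewrite -(convex_hull3 (v iC)) -(range_vertices v CA CB AB) hK.2.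
  have [w [affU UC Uw wC wd]] := angle_bisectorE CA CB AB bis KE' crossC.
  rewrite eBC eAC in wd.
  apply: (chirality_attained affU (m := y / x)) => [V affV|].
    apply: lower => //.
    + by rewrite divr_ge0 // ltW.
    + by rewrite mulrAC ler_pdivrMr // mul1r -expr2.
    + by rewrite divfK // gt_eqF.
    + rewrite ler_pdivrMr //.
      (* This product equals [x (1 + y^2 - x^2) - y]. *)
      have : 0 <= (y - x) * (x * (x + y) - 1) by apply: mulr_ge0; lra.
      lra.
  rewrite KE; exact: (largest_bisector_upper_bound (erefl _) hx hxy eBC eAC eAB
    p2 p1 h0 xE yE affU UC Uw wC wd).
- move=> /(regionS_ineq hy0 hy0_eq)[xy2' x2y] U [i [imin bis]].
  have iE : i = iA.
    have [//|iE|iE] := index_cases i AB AC BC.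
      by have := imin iA; rewrite iE leNgt angAB.
    by have := imin iA; rewrite iE leNgt angAC.
  rewrite iE in bis.
  have [w [affU UA Uw wA wd]] := angle_bisectorE AB AC BC bis KE crossA.
  rewrite eCA eBA scale1r in wd.
  apply: (chirality_attained affU (m := 1 / y)) => [V affV|].
    apply: lower => //.
    + by rewrite divr_ge0 // ltW.
    + by rewrite divfK // gt_eqF.
    + by rewrite mul1r mulrC ler_pdivrMr // -expr2.
    + rewrite ler_pdivrMr //; lra.
  rewrite KE; exact: (smallest_bisector_upper_bound (erefl _) hx hxy hy
    eBC eAC eAB p2 h0 xE yE affU UA Uw wA wd).
- move=> /(regionP_ineq hy0 hy0_eq)[xyx x2y] U [affU [i [imax perp]]].
  have iE : i = iC.
    have [iE|iE|//] := index_cases i AB AC BC.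
      by have := imax iC; rewrite iE sA sC leNgt x1.
    by have := imax iC; rewrite iE sB sC leNgt hy.
  have perp' u w : U u -> U w -> dot (u - w) (v iA - v iB) = 0.
    move=> Uu Uw; have := perp u w Uu Uw; rewrite iE.
    case: (other_indices CA CB AB) => -[-> ->] // h1.
    have -> : v iA - v iB = - (v iB - v iA) by rewrite opprB.
    by rewrite dotNr h1 oppr0.
  apply: (chirality_attained affU (m := 1 + y ^+ 2 - x ^+ 2)) => [V affV|].
    apply: lower => //; first lra.
    + lra.
    (* The same factorisation as for the largest angle, with the opposite sign. *)
    + have : 0 <= (y - x) * (1 - x * (x + y)) by apply: mulr_ge0; lra.
      lra.
  rewrite KE; exact: (perp_longest_upper_bound (erefl _) eBC eAC eAB
    p2 h0 xE yE affU perp').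
Qed.
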